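(* Let $U\subset\mathbb{C}$ be an open set and let $b:U\to\mathbb{C}$ be a complex analytic function. Then the Hill vector field $$X(x,y,z)=y\frac{\partial}{\partial x}-b(z)x\frac{\partial}{\partial y}+\frac{\partial}{\partial z}$$ on $\mathbb{C}^2\times U$ is w-integrable; that is, $X$ is tangent to a (possibly singular) codimension one complex analytic foliation of $\mathbb{C}^2\times U$.
   Context: The vector field $X$ is the order reduction, via $x=u$, $y=u'$, $z=z$, of the second order equation $u''(z)+b(z)u(z)=0$; it is called the Hill vector field of this equation. A complex vector field $X$ on an open set $W\subset\mathbb{C}^3$ is called w-integrable (integrable in the weak sense) if it is tangent to a codimension one, possibly singular, complex analytic foliation $\mathcal{F}$ of $W$. Such a foliation is given by a complex analytic 1-form $\omega$ on $W$ that is not identically zero (its singular set being the zero set of $\omega$, of codimension at least two) and satisfies the integrability condition $\omega\wedge d\omega=0$; tangency of $X$ to $\mathcal{F}$ means $\omega(X)\equiv 0$. *)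

(* Defs.v *)
From HB Require Import structures.
From mathcomp Require Import all_boot all_order all_algebra.
From mathcomp Require Import all_classical all_reals all_analysis.
From mathcomp Require Import complex.

Set Implicit Arguments.
Unset Strict Implicit.
Unset Printing Implicit Defensive.

Import Order.TTheory GRing.Theory Num.Theory.
Import numFieldNormedType.Exports.

Local Open Scope classical_set_scope.
Local Open Scope ring_scope.

(* R[i] has no topology of its own; seen as a numFieldType it gets the one
   given by its modulus. *)
Definition Cplx (R : realType) : numFieldType := R[i].

(* The definitions below make sense over any K, but they are the notions of
   complex analytic geometry only for K = Cplx R. *)
Section ComplexAnalytic.
Variable K : numFieldType.

Definition power_term (n : nat) (c : ('I_n -> nat) -> K) (h : 'rV[K]_n)
    (a : 'I_n -> nat) : K :=
  c a * \prod_(i < n) h 0 i ^+ a i.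

(* On some polydisc around p, f is the sum of an absolutely convergent power
   series in n variables. The partial sums are taken over the multi-indices
   with all entries < N; absolute convergence makes that choice immaterial. *)
Definition analytic_at (n : nat) (f : 'rV[K]_n -> K) (p : 'rV[K]_n) : Prop :=
  exists c : ('I_n -> nat) -> K, exists2 r : K, 0 < r &
    forall h : 'rV[K]_n, (forall i, `|h 0 i| < r) ->
      (exists M : K, forall N : nat,
        \sum_(a : {ffun 'I_n -> 'I_N}) `|power_term c h (fun i => a i)| <= M) /\
      (fun N : nat => \sum_(a : {ffun 'I_n -> 'I_N})
         power_term c h (fun i => a i)) @ \oo --> f (p + h).

(* Meant for open W. *)
Definition analytic_on (n : nat) (W : set 'rV[K]_n) (f : 'rV[K]_n -> K) : Prop :=
  forall p, W p -> analytic_at f p.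

Definition analytic1_on (U : set K) (b : K -> K) : Prop :=
  analytic_on [set u : 'rV[K]_1 | U (u 0 0)] (fun u => b (u 0 0)).

(* For vector fields, 1-forms (through their coefficients in the basis
   dx_0, ..., dx_(m-1)) and maps. *)
Definition analytic_map_on (n m : nat) (W : set 'rV[K]_n)
    (F : 'rV[K]_n -> 'rV[K]_m) : Prop :=
  forall j, analytic_on W (fun p => F p 0 j).

Definition partial (n : nat) (i : 'I_n) (f : 'rV[K]_n -> K) (p : 'rV[K]_n) : K :=
  'D_(delta_mx 0 i) f p.

Definition jacobian_mx (d n : nat) (F : 'rV[K]_d -> 'rV[K]_n) (u : 'rV[K]_d) :
    'M[K]_(d, n) :=
  \matrix_(i, j) partial i (fun v => F v 0 j) u.

(* Near p, S is a complex submanifold of dimension d: it is the homeomorphic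
   image of an open set of K^d under an analytic immersion. *)
Definition regular_point (n : nat) (S : set 'rV[K]_n) (d : nat) (p : 'rV[K]_n) :
    Prop :=
  S p /\
  exists (V : set 'rV[K]_n) (D : set 'rV[K]_d)
         (phi : 'rV[K]_d -> 'rV[K]_n) (psi : 'rV[K]_n -> 'rV[K]_d),
    [/\ open V /\ V p,
        open D /\ analytic_map_on D phi,
        forall u, D u -> \rank (jacobian_mx phi u) = d,
        phi @` D = S `&` V /\ (forall u, D u -> psi (phi u) = u) &
        {within S `&` V, continuous psi}].

(* The dimension of an analytic set is the largest of the dimensions of its
   regular points, so this says that the codimension of S is at least k. It
   holds for S = set0, and for k > 0 it fails if S has interior points. *)
Definition codim_ge (n : nat) (k : nat) (S : set 'rV[K]_n) : Prop :=
  forall (d : nat) (p : 'rV[K]_n), regular_point S d p -> (d + k <= n)%N.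

(* Coefficient (d omega)(e_i, e_j) of the exterior derivative. *)
Definition dform (n : nat) (omega : 'rV[K]_n -> 'rV[K]_n) (i j : 'I_n)
    (p : 'rV[K]_n) : K :=
  partial i (fun q => omega q 0 j) p - partial j (fun q => omega q 0 i) p.

(* Coefficient (omega /\ d omega)(e_i, e_j, e_k). *)
Definition wedge_dform (n : nat) (omega : 'rV[K]_n -> 'rV[K]_n) (i j k : 'I_n)
    (p : 'rV[K]_n) : K :=
  omega p 0 i * dform omega j k p + omega p 0 j * dform omega k i p
    + omega p 0 k * dform omega i j p.

(* The second clause is "not identically zero on W"; the premise only discards
   the case W = set0, in which no form could satisfy it. *)
Definition foliation_form (n : nat) (W : set 'rV[K]_n)
    (omega : 'rV[K]_n -> 'rV[K]_n) : Prop :=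
  [/\ analytic_map_on W omega,
      W !=set0 -> exists2 p, W p & omega p != 0,
      codim_ge 2 [set p | W p /\ omega p = 0] &
      forall p, W p -> forall i j k, wedge_dform omega i j k p = 0].

Definition tangent_to_form (n : nat) (W : set 'rV[K]_n)
    (X omega : 'rV[K]_n -> 'rV[K]_n) : Prop :=
  forall p, W p -> \sum_(i < n) omega p 0 i * X p 0 i = 0.

Definition w_integrable (W : set 'rV[K]_3) (X : 'rV[K]_3 -> 'rV[K]_3) : Prop :=
  exists omega, foliation_form W omega /\ tangent_to_form W X omega.

(* The point (x, y, z) is p with x = p 0 0, y = p 0 1, z = p 0 2. *)
Definition C2_times (U : set K) : set 'rV[K]_3 := [set p | U (p 0 2)].

Definition hill_field (b : K -> K) (p : 'rV[K]_3) : 'rV[K]_3 :=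
  let x := p 0 0 in let y := p 0 1 in let z := p 0 2 in
  \row_(i < 3) [:: y; - b z * x; 1]`_i.

End ComplexAnalytic.

(* Main.v *)
Require Import Defs.
From mathcomp Require Import all_boot all_order all_algebra.
From mathcomp Require Import all_classical all_reals all_analysis.
From mathcomp Require Import ring.
Import numFieldNormedType.Exports.
Import Order.TTheory GRing.Theory Num.Theory.

(** The Hill equation is linear, so its flow acts on the lines through the
    origin of C^2: the slope w = y / x satisfies the Riccati equation
    w' = - b(z) - w^2. The plane of the pair (w, z) carries the foliation by the
    graphs of Riccati solutions, given by dw + (b(z) + w^2) dz, and X is tangent
    to its pullback under (x, y, z) |-> (y / x, z). Multiplying by x^2 clears the
    pole and leaves the globally defined form
      omega = - y dx + x dy + (b(z) x^2 + y^2) dz,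
    so no solution of the Hill equation has to be found, and the topology of U
    does not matter.

    What remains to be checked about omega:
    - It is analytic, since each coefficient is a sum of products of
      one-variable analytic functions of distinct coordinates
      ([analytic_at_prod], [analytic_at_add]).
    - It is integrable. The derivative of b only enters through
      b'(z) x^2 dz /\ dz = 0, so the three coefficients of d omega are
      polynomial in x, y and b(z) ([dform_riccati]), and they cancel in
      omega /\ d omega ([riccati_form_integrable]).
    - It vanishes exactly where x = y = 0, a subset of the z-axis, so its
      singular set has codimension at least two ([codim_ge_axis]). *)

Set Implicit Arguments.
Unset Strict Implicit.
Unset Printing Implicit Defensive.

Local Open Scope classical_set_scope.
Local Open Scope ring_scope.

(** * Products and sums of power series *)

Lemma ord3P (P : 'I_3 -> Prop) : P 0 -> P 1 -> P 2 -> forall i, P i.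
Proof.
move=> P0 P1 P2 [[|[|[|//]]] i3].
- by move: P0; congr P; apply/val_inj.
- by move: P1; congr P; apply/val_inj.
- by move: P2; congr P; apply/val_inj.
Qed.

Section PowerSeries.
Variable K : numFieldType.

(** Analyticity of a function of one variable, stated with ordinary scalar
    power series instead of multi-indices with one entry. *)
Definition power_series_at (f : K -> K) (z : K) : Prop :=
  exists c : nat -> K, exists2 r : K, 0 < r &
    forall h : K, `|h| < r ->
      (exists M : K, forall N : nat, \sum_(j < N) `|c j * h ^+ j| <= M) /\
      (fun N : nat => \sum_(j < N) c j * h ^+ j) @ \oo --> f (z + h).

Lemma analytic1_on_power_series (U : set K) (b : K -> K) (z : K) :
  analytic1_on U b -> U z -> power_series_at b z.
Proof.
move=> bU Uz; have [|c [r r0 cb]] := bU (const_mx z); first by rewrite /= mxE.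
exists (fun j => c (fun=> j)), r => // h hr.
(* A multi-index with one entry is a constant function on 'I_1. *)
have sumE (F : ('I_1 -> nat) -> K) N :
    \sum_(a : {ffun 'I_1 -> 'I_N}) F (fun i => a i) =
    \sum_(j < N) F (fun=> nat_of_ord j).
  rewrite (reindex (fun j : 'I_N => [ffun=> j] : {ffun 'I_1 -> 'I_N})) /=.
    by apply: eq_bigr => j _; congr F; apply/funext => i; rewrite ffunE.
  exists (fun a : {ffun 'I_1 -> 'I_N} => a 0) => [j _|a _]; first by rewrite ffunE.
  by apply/ffunP => i; rewrite ffunE (ord1 i).
have termE j : power_term c (const_mx h) (fun=> j) = c (fun=> j) * h ^+ j.
  by rewrite /power_term big_ord1 mxE.
have [|[M cM] cf] := cb (const_mx h); first by move=> i; rewrite mxE.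
split.
  exists M => N; apply: le_trans (cM N).
  rewrite (sumE (fun a => `|power_term c (const_mx h) a|)).
  by apply: ler_sum => j _; rewrite termE.
move: cf; rewrite !mxE; apply: cvg_trans; apply: near_eq_cvg.
apply: nearW => N; rewrite sumE.
by apply: eq_bigr => j _; rewrite termE.
Qed.

(** The expansion at z has the coefficients of p(X + z), and its partial sums
    are stationary. *)
Lemma horner_power_series (p : {poly K}) (z : K) :
  power_series_at (horner p) z.
Proof.
pose q := p \Po ('X + z%:P).
exists (fun j => q`_j), 1 => // h _; split.
  exists (\sum_(j < size q) `|q`_j * h ^+ j|) => N.
  pose F j := `|q`_j * h ^+ j|.
  have F0 j : (size q <= j)%N -> F j = 0.
    by move=> qj; rewrite /F nth_default// mul0r normr0.
  (* Both sums embed in the one of length [maxn N (size q)]. *)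
  have -> : \sum_(j < size q) F j = \sum_(j < maxn N (size q)) F j.
    rewrite (big_ord_widen (maxn N (size q)) F) ?leq_maxr//.
    rewrite [RHS](bigID (fun j : 'I__ => (j < size q)%N))/=.
    by rewrite [X in _ + X]big1 ?addr0// => j; rewrite -leqNgt => /F0.
  rewrite (big_ord_widen (maxn N (size q)) F) ?leq_maxl//.
  rewrite [leRHS](bigID (fun j : 'I__ => (j < N)%N))/= lerDl.
  by apply: sumr_ge0 => j _; exact: normr_ge0.
apply: cvg_near_cst; exists (size q) => // N /= qN.
by rewrite -horner_coef_wide// /q horner_comp !hornerE addrC.
Qed.

(** The product of the expansions in each variable has the product coefficients.
    Because partial sums run over cubes of multi-indices, distributivity makes
    them equal to the product of the one-variable partial sums, which settles
    convergence and absolute convergence without any Cauchy product. *)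
Lemma analytic_at_prod n (f : 'I_n -> K -> K) (p : 'rV[K]_n) :
  (forall i, power_series_at (f i) (p 0 i)) ->
  analytic_at (fun q => \prod_(i < n) f i (q 0 i)) p.
Proof.
move=> fp.
have /fin_all_exists [c /fin_all_exists2 [r r0 cr]] := fp.
(* The inverse of [s] is a common radius: it is positive and below every
   [r i], without taking minima in a field that is only partially ordered. *)
pose s := 1 + \sum_i (r i)^-1.
have s0 : 0 < s.
  by apply: ltr_pwDl => //; apply: sumr_ge0 => i _; rewrite invr_ge0 ltW.
have sr i : s^-1 <= r i.
  rewrite -[leRHS]invrK lef_pV2 ?posrE ?invr_gt0//.
  rewrite /s (bigD1 i)//= addrCA lerDl addr_ge0// sumr_ge0// => j _.
  by rewrite invr_ge0 ltW.
exists (fun a => \prod_i c i (a i)), s^-1; first by rewrite invr_gt0.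
move=> h hs.
have {}cr i := cr i (h 0 i) (lt_le_trans (hs i) (sr i)).
have [/fin_all_exists [M cM] cf] := all_and2 cr.
have termE N (a : {ffun 'I_n -> 'I_N}) :
    power_term (fun a => \prod_i c i (a i)) h (fun i => a i) =
    \prod_i (c i (a i) * h 0 i ^+ a i).
  by rewrite /power_term big_split.
split.
  exists (\prod_i M i) => N.
  under [leLHS]eq_bigr => a _ do rewrite termE normr_prod.
  rewrite -(bigA_distr_bigA (fun i (j : 'I_N) => `|c i j * h 0 i ^+ j|)).
  by apply: ler_prod => i _; rewrite cM sumr_ge0.
have -> : (fun N : nat => \sum_(a : {ffun 'I_n -> 'I_N})
    power_term (fun a => \prod_i c i (a i)) h (fun i => a i)) =
    (fun N => \prod_i \sum_(j < N) (c i j * h 0 i ^+ j)).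
  apply/funext => N; under [LHS]eq_bigr => a _ do rewrite termE.
  by rewrite -(bigA_distr_bigA (fun i (j : 'I_N) => c i j * h 0 i ^+ j)).
under eq_bigr => i _ do rewrite mxE.
apply: cvg_big => [|i _]; last exact: cf.
exact: mul_continuous.
Qed.

Lemma analytic_at_add n (f g : 'rV[K]_n -> K) (p : 'rV[K]_n) :
  analytic_at f p -> analytic_at g p -> analytic_at (fun q => f q + g q) p.
Proof.
move=> [c [r r0 cf]] [d [s s0 dg]].
have [t t0 [tr ts]] : exists2 t : K, 0 < t & t <= r /\ t <= s.
  by case: (real_leP (gtr0_real r0) (gtr0_real s0)) => [rs|/ltW sr];
    [exists r|exists s].
exists (fun a => c a + d a), t => // h ht.
have [|[M cM] {}cf] := cf h; first by move=> i; exact: lt_le_trans (ht i) tr.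
have [|[L dL] {}dg] := dg h; first by move=> i; exact: lt_le_trans (ht i) ts.
have termE a : power_term (fun a => c a + d a) h a =
    power_term c h a + power_term d h a by exact: mulrDl.
split.
  exists (M + L) => N; apply: le_trans (lerD (cM N) (dL N)).
  by rewrite -big_split; apply: ler_sum => a _; rewrite termE ler_normD.
under eq_cvg => N do (under eq_bigr => a _ do rewrite termE; rewrite big_split/=).
exact: cvgD.
Qed.

Lemma analytic_at_prod3 (f g k : K -> K) (p : 'rV[K]_3) :
  power_series_at f (p 0 0) -> power_series_at g (p 0 1) ->
  power_series_at k (p 0 2) ->
  analytic_at (fun q => f (q 0 0) * g (q 0 1) * k (q 0 2)) p.
Proof.
move=> fp gp kp; pose F (i : 'I_3) := nth k [:: f; g; k] i.
have -> : (fun q : 'rV[K]_3 => f (q 0 0) * g (q 0 1) * k (q 0 2)) =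
    (fun q => \prod_(i < 3) F i (q 0 i)).
  apply/funext => q; rewrite !big_ord_recl big_ord0 mulr1 mulrA.
  by congr (f _ * g _ * k _); congr (q _ _); apply/val_inj.
by apply: analytic_at_prod; elim/ord3P.
Qed.

End PowerSeries.

(** * Partial derivatives and codimension *)

Section Partial.
Variable K : numFieldType.

(** The coefficients of the form below are at most quadratic along each of the
    coordinate lines on which their derivative matters, so the difference
    quotient is A + t B and no differentiability of b is involved. *)
Lemma partial_quadratic n (i : 'I_n) (f : 'rV[K]_n -> K) (p : 'rV[K]_n) (A B : K) :
  (forall t, f (t *: delta_mx 0 i + p) = f p + t * A + t ^+ 2 * B) ->
  partial i f p = A.
Proof.
move=> fE; rewrite /partial /derive; apply: cvg_lim; first exact: norm_hausdorff.
apply: (@cvg_trans _ ((fun t : K => A + t * B) @ 0^')).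
  apply: near_eq_cvg; near=> t; rewrite /= fE -[_ *: _]/(_ * _).
  have t0 : t != 0 by near: t; exact: nbhs_dnbhs_neq.
  by field.
suff : (fun t : K => A + t * B) @ 0^' --> A + 0 * B by rewrite mul0r addr0.
apply: cvgD; first exact: cvg_cst.
apply: cvgM; last exact: cvg_cst.
exact/cvg_within.
Unshelve. all: by end_near.
Qed.

Lemma partial_local_zero n (D : set 'rV[K]_n) (i : 'I_n) (f : 'rV[K]_n -> K) u :
  open D -> D u -> (forall v, D v -> f v = 0) -> partial i f u = 0.
Proof.
move=> oD Du f0; rewrite /partial (@near_eq_derive _ _ _ f (cst 0)).
  exact: derive_cst.
by near=> v; apply: f0; near: v; exact: open_nbhs_nbhs.
Unshelve. all: by end_near.
Qed.

(** In a local parametrization phi of a submanifold contained in the k-th axis,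
    all components but the k-th vanish identically; so all columns of the
    Jacobian but the k-th vanish, and its rank, which is the dimension, is at
    most one. *)
Lemma codim_ge_axis n (k : 'I_n.+1) (S : set 'rV[K]_n.+1) :
  (forall p, S p -> forall j, j != k -> p 0 j = 0) -> codim_ge n S.
Proof.
move=> S0 d p [Sp [V [D [phi [psi [[_ Vp] [oD _] rk [phiD _] _]]]]]].
have [u Du _] : (phi @` D) p by rewrite phiD.
suff d1 : (d <= 1)%N by rewrite addnC -addn1 leq_add2l.
rewrite -(rk u Du).
(* A matrix whose only nonzero column is the k-th factors through K^1. *)
have -> : jacobian_mx phi u = col k (jacobian_mx phi u) *m delta_mx 0 k.
  apply/matrixP => i j; rewrite [RHS]mxE big_ord1 [X in _ * X]mxE eqxx/=.
  have [->|jk] := eqVneq j k; first by rewrite mulr1 !mxE.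
  rewrite mulr0 mxE; apply: (partial_local_zero _ oD Du) => v Dv.
  have [Sv _] : (S `&` V) (phi v) by rewrite -phiD; exists v.
  exact: S0.
exact: mulmx_max_rank.
Qed.

End Partial.

(** * The Riccati form of the Hill field *)

Section Hill.
Variable K : numFieldType.
Implicit Type b : K -> K.

(** x^2 times the pullback of dw + (b(z) + w^2) dz under w = y / x. *)
Definition riccati_form b (p : 'rV[K]_3) : 'rV[K]_3 :=
  let x := p 0 0 in let y := p 0 1 in let z := p 0 2 in
  \row_(i < 3) [:: - y; x; b z * x ^+ 2 + y ^+ 2]`_i.

Lemma riccati_formE b p :
  [/\ riccati_form b p 0 0 = - p 0 1, riccati_form b p 0 1 = p 0 0 &
      riccati_form b p 0 2 = b (p 0 2) * p 0 0 ^+ 2 + p 0 1 ^+ 2].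
Proof. by split; rewrite mxE. Qed.

Lemma riccati_form_analytic (U : set K) b :
  analytic1_on U b -> analytic_map_on (C2_times U) (riccati_form b).
Proof.
move=> bU j p Up.
have bp := analytic1_on_power_series bU Up.
have mon f (P Q : {poly K}) :
    power_series_at f (p 0 2) ->
    analytic_at (fun q : 'rV_3 => P.[q 0 0] * Q.[q 0 1] * f (q 0 2)) p.
  by apply: analytic_at_prod3; exact: horner_power_series.
have one : power_series_at (fun=> 1) (p 0 2).
  have := horner_power_series 1 (p 0 2); congr power_series_at.
  by apply/funext => z; rewrite hornerC.
have eqA (f g : 'rV[K]_3 -> K) : f =1 g -> analytic_at g p -> analytic_at f p.
  by move=> /funext ->.
elim/ord3P: j.
- apply: eqA (mon _ 1 (- 'X) one) => q; have [-> _ _] := riccati_formE b q.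
  by rewrite !hornerE.
- apply: eqA (mon _ 'X 1 one) => q; have [_ -> _] := riccati_formE b q.
  by rewrite !hornerE.
- apply: eqA (analytic_at_add (mon _ 'X^2 1 bp) (mon _ 1 'X^2 one)) => q.
  by have [_ _ ->] := riccati_formE b q; rewrite !(hornerXn, hornerC) !(mulr1, mul1r) mulrC.
Qed.

(** The derivative of the dz-coefficient in the z-direction, hence the derivative
    of b, does not occur in any of these. *)
Lemma dform_riccati b p :
  [/\ dform (riccati_form b) 0 1 p = 2,
      dform (riccati_form b) 1 2 p = 2 * p 0 1 &
      dform (riccati_form b) 2 0 p = - (2 * b (p 0 2) * p 0 0)].
Proof.
pose w j q := riccati_form b q 0 j.
have pw i j A B : (forall t, w j (t *: delta_mx 0 i + p) = w j p + t * A + t ^+ 2 * B) ->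
  partial i (w j) p = A by exact: partial_quadratic.
have E q := riccati_formE b q.
have line i t j : (t *: delta_mx 0 i + p : 'rV_3) 0 j = t * (j == i)%:R + p 0 j.
  by rewrite !mxE eqxx.
split; rewrite /dform -!/(w _).
- rewrite (pw 0 1 1 0) ?(pw 1 0 (-1) 0) ?opprK// => t; rewrite /w.
  + by have [-> _ _] := E p; have [-> _ _] := E (t *: delta_mx 0 1 + p);
      rewrite !line /=; ring.
  + by have [_ -> _] := E p; have [_ -> _] := E (t *: delta_mx 0 0 + p);
      rewrite !line /=; ring.
- rewrite (pw 1 2 (2 * p 0 1) 1) ?(pw 2 1 0 0) ?subr0// => t; rewrite /w.
  + by have [_ -> _] := E p; have [_ -> _] := E (t *: delta_mx 0 2 + p);
      rewrite !line /=; ring.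
  + by have [_ _ ->] := E p; have [_ _ ->] := E (t *: delta_mx 0 1 + p);
      rewrite !line /= !mulr0 !add0r; ring.
- rewrite (pw 2 0 0 0) ?(pw 0 2 (2 * b (p 0 2) * p 0 0) (b (p 0 2))) ?sub0r// => t; rewrite /w.
  + by have [_ _ ->] := E p; have [_ _ ->] := E (t *: delta_mx 0 0 + p);
      rewrite !line /= !mulr0 !add0r; ring.
  + by have [-> _ _] := E p; have [-> _ _] := E (t *: delta_mx 0 2 + p);
      rewrite !line /=; ring.
Qed.

(** omega /\ d omega is alternating, so all cases reduce to the coefficient on
    dx /\ dy /\ dz, which is
    - y (2 y) + x (- 2 b x) + 2 (b x^2 + y^2) = 0. *)
Lemma riccati_form_integrable b i j k p :
  wedge_dform (riccati_form b) i j k p = 0.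
Proof.
have dC l m : dform (riccati_form b) l m p = - dform (riccati_form b) m l p.
  by rewrite /dform opprB.
have d0 l : dform (riccati_form b) l l p = 0 by rewrite /dform subrr.
have [d01 d12 d20] := dform_riccati b p.
have [w0 w1 w2] := riccati_formE b p.
have d10 := dC 1 0; have d21 := dC 2 1; have d02 := dC 0 2.
rewrite d01 in d10; rewrite d12 in d21; rewrite d20 in d02.
rewrite /wedge_dform; elim/ord3P: i; elim/ord3P: j; elim/ord3P: k;
  rewrite ?d0 ?d01 ?d12 ?d20 ?d10 ?d21 ?d02 ?w0 ?w1 ?w2; ring.
Qed.

Lemma hill_field_w_integrable (U : set K) b :
  analytic1_on U b -> w_integrable (C2_times U) (hill_field b).
Proof.
move=> bU; exists (riccati_form b); split; first split.
- exact: riccati_form_analytic.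
- move=> [p Up].
  (* At (1, 0, z) the dy-coefficient is 1. *)
  pose q : 'rV[K]_3 := delta_mx 0 0 + p 0 2 *: delta_mx 0 2.
  exists q; first by rewrite /C2_times /= !mxE/= mulr1 add0r.
  apply/eqP => /rowP/(_ 1); have [_ -> _] := riccati_formE b q.
  by rewrite !mxE/= mulr0 addr0 => /eqP; rewrite oner_eq0.
- apply: (@codim_ge_axis _ 2 2) => p [_ wp].
  have [w0 w1 _] := riccati_formE b p.
  elim/ord3P => //= _; first by rewrite -w1 wp mxE.
  by apply: oppr_inj; rewrite -w0 wp mxE oppr0.
- by move=> p _ i j k; exact: riccati_form_integrable.
- move=> p _; rewrite !big_ord_recl big_ord0 !mxE/=.
  ring.
Qed.

End Hill.

Theorem theorem1 (R : realType) (U : set (Cplx R)) (b : Cplx R -> Cplx R) :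
  open U -> analytic1_on U b -> w_integrable (C2_times U) (hill_field b).
Proof. by move=> _; exact: hill_field_w_integrable. Qed.
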